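(* Consider the multinomial logistic model $\mathbf C^T\log(\mathbf L\boldsymbol\pi_i)=\mathbf X_i\boldsymbol\theta$, $i=1,\dots,m$ (see context), with independent observations. Then the Fisher information matrix of $\boldsymbol\theta$ is $\mathbf F=\mathbf H\mathbf U\mathbf H^T$, where $\mathbf U=(\mathbf U_{st})_{s,t=1,\dots,J-1}$ is the $m(J-1)\times m(J-1)$ block matrix with $\mathbf U_{st}={\rm diag}\{n_1u_{st}(\boldsymbol\pi_1),\dots,n_mu_{st}(\boldsymbol\pi_m)\}$, and $\mathbf H$ is the $p\times m(J-1)$ matrix $$\mathbf H=\begin{pmatrix}\mathbf H_1&&\\&\ddots&\\&&\mathbf H_{J-1}\\ \mathbf H_c&\cdots&\mathbf H_c\end{pmatrix},$$ with $\mathbf H_j=(\mathbf h_j(\mathbf x_1),\dots,\mathbf h_j(\mathbf x_m))$ and $\mathbf H_c=(\mathbf h_c(\mathbf x_1),\dots,\mathbf h_c(\mathbf x_m))$.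
   Context: Let $d\ge 1$, $m\ge 2$, $J\ge 2$ be integers, $\mathbf x_1,\dots,\mathbf x_m\in\mathbb R^d$ distinct experimental settings, and $n_1,\dots,n_m\ge 0$ integers with $n=\sum_i n_i>0$. For each $i$ with $n_i>0$ one observes $\mathbf Y_i=(Y_{i1},\dots,Y_{iJ})^T\sim{\rm Multinomial}(n_i;\pi_{i1},\dots,\pi_{iJ})$, independently over $i$; write $\boldsymbol\pi_i=(\pi_{i1},\dots,\pi_{iJ})^T$, $\sum_j\pi_{ij}=1$. Model. Known functions $\mathbf h_j$ with values in $\mathbb R^{p_j}$ ($j=1,\dots,J-1$) and $\mathbf h_c$ with values in $\mathbb R^{p_c}$ are given; the parameter is $\boldsymbol\theta=(\boldsymbol\beta_1^T,\dots,\boldsymbol\beta_{J-1}^T,\boldsymbol\zeta^T)^T\in\mathbb R^p$ with $\boldsymbol\beta_j\in\mathbb R^{p_j}$, $\boldsymbol\zeta\in\mathbb R^{p_c}$, $p=p_1+\dots+p_{J-1}+p_c$. ($p_c=0$, i.e. no $\mathbf h_c,\boldsymbol\zeta$, is allowed.) For one fixed choice among four logit types, $\log(\nu_{ij}/\delta_{ij})=\mathbf h_j^T(\mathbf x_i)\boldsymbol\beta_j+\mathbf h_c^T(\mathbf x_i)\boldsymbol\zeta$ for $j=1,\dots,J-1$, where $(\nu_{ij},\delta_{ij})$ is: $(\pi_{ij},\pi_{iJ})$ (baseline-category); $(\pi_{i1}+\dots+\pi_{ij},\ \pi_{i,j+1}+\dots+\pi_{iJ})$ (cumulative); $(\pi_{ij},\pi_{i,j+1})$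 (adjacent-categories); $(\pi_{ij},\ \pi_{i,j+1}+\dots+\pi_{iJ})$ (continuation-ratio). It is assumed that $\pi_{ij}>0$ for all $i,j$. Matrix form: $\mathbf C^T\log(\mathbf L\boldsymbol\pi_i)=\mathbf X_i\boldsymbol\theta$ with entrywise $\log$, where $\mathbf C^T=\begin{pmatrix}\mathbf I_{J-1}&-\mathbf I_{J-1}&\mathbf 0\\ \mathbf 0^T&\mathbf 0^T&1\end{pmatrix}$ is $J\times(2J-1)$; $\mathbf L$ is the $(2J-1)\times J$ 0-1 matrix with $(\mathbf L\boldsymbol\pi_i)_j=\nu_{ij}$, $(\mathbf L\boldsymbol\pi_i)_{J-1+j}=\delta_{ij}$ ($j=1,\dots,J-1$), and last row all ones; and $\mathbf X_i$ is the $J\times p$ matrix whose $j$th row ($j\le J-1$) has $\mathbf h_j^T(\mathbf x_i)$ in the block of columns of $\boldsymbol\beta_j$, $\mathbf h_c^T(\mathbf x_i)$ in the block of columns of $\boldsymbol\zeta$, and zeros elsewhere, and whose last row is zero. With $\mathbf D_i={\rm diag}(\mathbf L\boldsymbol\pi_i)$, the $J\times J$ matrix $\mathbf C^T\mathbf D_i^{-1}\mathbf L$ is nonsingular; write $(\mathbf C^T\mathbf D_i^{-1}\mathbf L)^{-1}=(\mathbf c_{i1},\dots,\mathbf c_{iJ})$ by columns, and $u_{st}(\boldsymbol\pi_i)=\mathbf c_{is}^T{\rm diag}(\boldsymbol\pi_i)^{-1}\mathbf c_{it}$ for $s,t=1,\dots,J-1$. The Fisher information matrix is the covariance matrix of the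 score vector $\partial l/\partial\boldsymbol\theta$, where $l$ is the log-likelihood of $(\mathbf Y_i)_i$. *)

(* Defs.v *)
From HB Require Import structures.
From mathcomp Require Import all_boot all_order all_algebra.
From mathcomp Require Import all_classical all_reals all_analysis.

Set Implicit Arguments.
Unset Strict Implicit.
Unset Printing Implicit Defensive.

Import Order.TTheory GRing.Theory Num.Theory.
Import numFieldNormedType.Exports.

Local Open Scope classical_set_scope.
Local Open Scope ring_scope.

(* Throughout, K = J - 1: there are K + 1 response categories, numbered from 0
   to K, and K logits, numbered from 0 to K - 1.  The vectors of R^n are the
   column vectors 'cV[R]_n. *)

Inductive logit_type := Baseline | Cumulative | Adjacent | Continuation.

Section Model.
Context {R : realType} {K : nat}.

(* Is category c a summand of nu_j (resp. of delta_j)? *)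
Definition in_nu (t : logit_type) (j c : nat) : bool :=
  match t with
  | Cumulative => (c <= j)%N
  | Baseline | Adjacent | Continuation => c == j
  end.

Definition in_delta (t : logit_type) (j c : nat) : bool :=
  match t with
  | Baseline => c == K
  | Adjacent => c == j.+1
  | Cumulative | Continuation => (j < c)%N
  end.

Definition Lmx (t : logit_type) : 'M[R]_(K + K + 1, K + 1) :=
  col_mx (col_mx (\matrix_(j < K, c < K + 1) (in_nu t j c)%:R)
                 (\matrix_(j < K, c < K + 1) (in_delta t j c)%:R))
         (const_mx 1).

Definition CTmx : 'M[R]_(K + 1, K + K + 1) :=
  block_mx (row_mx 1%:M (- 1%:M)) 0
           0                      1%:M.

(* C^T D^-1 L, where D = diag (L q) *)
Definition CDLmx (t : logit_type) (q : 'cV[R]_(K + 1)) : 'M[R]_(K + 1) :=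
  CTmx *m invmx (diag_mx (Lmx t *m q)^T) *m Lmx t.

Definition u_coef (t : logit_type) (q : 'cV[R]_(K + 1)) (r s : 'I_K) : R :=
  let c k := col (lshift 1 k) (invmx (CDLmx t q)) in
  ((c r)^T *m invmx (diag_mx q^T) *m c s) 0 0.

Section Predictor.
Context {d : nat} {p_ : 'I_K -> nat} {pc : nat}.
Variables (h : forall j : 'I_K, 'cV[R]_d -> 'cV[R]_(p_ j)).
Variables (hc : 'cV[R]_d -> 'cV[R]_pc).

(* The model matrix X_i, at the setting x = x_i. *)
Definition model_mx (x : 'cV[R]_d) : 'M[R]_(K + 1, \sum_(j < K) p_ j + pc) :=
  col_mx
    (row_mx
       (\mxrow_(b < K)
          (\matrix_(j < K, k < p_ b) if j == b then h b x k 0 else 0))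
       (\matrix_(j < K, k < pc) hc x k 0))
    0.

Definition Hmx (m : nat) (x : 'I_m -> 'cV[R]_d) :
    'M[R]_(\sum_(j < K) p_ j + pc, \sum_(s < K) m) :=
  col_mx
    (\mxblock_(j < K, s < K)
       (if j == s then \matrix_(k < p_ j, i < m) h j (x i) k 0 else 0))
    (\mxrow_(s < K) (\matrix_(k < pc, i < m) hc (x i) k 0)).

End Predictor.

Definition Umx (m : nat) (t : logit_type) (n : 'I_m -> nat)
    (q : 'I_m -> 'cV[R]_(K + 1)) : 'M[R]_(\sum_(r < K) m, \sum_(s < K) m) :=
  \mxblock_(r < K, s < K)
    diag_mx (\row_(i < m) ((n i)%:R * u_coef t (q i) r s)).

Section CellProbabilities.
Context {p : nat}.
Variables (t : logit_type) (X : 'M[R]_(K + 1, p)) (theta : 'cV[R]_p).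

Definition is_cell_prob (q : 'cV[R]_(K + 1)) : Prop :=
  [/\ forall c, 0 < q c 0,
      \sum_c q c 0 = 1 &
      CTmx *m map_mx (@ln R) (Lmx t *m q) = X *m theta].

(* The model equation has at most one solution with positive entries; for
   cumulative logits it may have none, in which case the value is junk. *)
Definition cell_prob : 'cV[R]_(K + 1) := xget 0 [set q | is_cell_prob q].

End CellProbabilities.

(* The parameters for which the model makes sense at all settings. *)
Definition feasible {m p : nat} (t : logit_type)
    (X : 'I_m -> 'M[R]_(K + 1, p)) (theta : 'cV[R]_p) : Prop :=
  forall i, exists q, is_cell_prob t (X i) theta q.

Definition multinomial_pmf (N : nat) (q : 'cV[R]_(K + 1))
    (y : (K + 1).-tuple nat) : R :=
  if (\sum_c tnth y c)%N == N then
    N`!%:R / (\prod_c (tnth y c)`!%:R) * \prod_c q c 0 ^+ tnth y c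
  else 0.

(* Only the settings with n_i > 0 are observed. *)
Definition loglik {m p : nat} (t : logit_type) (n : 'I_m -> nat)
    (X : 'I_m -> 'M[R]_(K + 1, p)) (y : 'I_m -> (K + 1).-tuple nat)
    (theta : 'cV[R]_p) : R :=
  ln (\prod_(i | (0 < n i)%N)
        multinomial_pmf (n i) (cell_prob t (X i) theta) (y i)).

Definition score {m p : nat} (t : logit_type) (n : 'I_m -> nat)
    (X : 'I_m -> 'M[R]_(K + 1, p)) (theta : 'cV[R]_p)
    (y : 'I_m -> (K + 1).-tuple nat) (a : 'I_p) : R :=
  'D_(delta_mx a 0) (loglik t n X y) theta.

End Model.

Section Probability.
Context {R : realType} {disp : measure_display} {T : measurableType disp}.
Variable P : probability T R.

(* The random variables Y i, for i ranging over D, are mutually independent. *)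
Definition mutually_independent {I : finType} {disp' : measure_display}
    {T' : measurableType disp'} (D : pred I) (Y : I -> {RV P >-> T'}) : Prop :=
  forall (A : {set I}) (B : I -> set T'),
    {subset A <= D} -> (forall i, measurable (B i)) ->
    P (\bigcap_(i in [set` A]) (Y i @^-1` B i)) =
    (\prod_(i in A) P (Y i @^-1` B i))%E.

Definition multinomial_law {K : nat} (N : nat) (q : 'cV[R]_(K + 1))
    (Y : {RV P >-> (K + 1).-tuple nat}) : Prop :=
  forall y, distribution P Y [set y] = (multinomial_pmf N q y)%:E.

(* The covariance matrix of the score vector; its entries are extended reals,
   as are the covariances of the library. *)
Definition fisher_info {K m p : nat} (t : logit_type) (n : 'I_m -> nat)
    (X : 'I_m -> 'M[R]_(K + 1, p)) (Y : 'I_m -> {RV P >-> (K + 1).-tuple nat})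
    (theta : 'cV[R]_p) : 'M[\bar R]_p :=
  let S a w := score t n X theta (fun i => Y i w) a in
  \matrix_(a, b) covariance P (S a) (S b).

End Probability.

(* Main.v *)
Require Import Defs.
From HB Require Import structures.
From mathcomp Require Import all_boot all_order all_algebra.
From mathcomp Require Import all_classical all_reals all_analysis.
From mathcomp Require Import ring.

Set Implicit Arguments.
Unset Strict Implicit.
Unset Printing Implicit Defensive.

Import Order.TTheory GRing.Theory Num.Theory.
Import numFieldNormedType.Exports.

Local Open Scope classical_set_scope.
Local Open Scope ring_scope.

(** At a setting x_i, the logit equations together with the total mass form a
    linear system A(eta) q = e_J in the cell probabilities, whose coefficients
    are smooth in the linear predictor eta = X_i theta.  Positivity of one
    solution makes A(eta) invertible, so Cramer's rule shows that pi_i is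
    differentiable in theta and stays positive near theta; differentiating
    C^T log(L pi_i) = X_i theta then gives
    d pi_i / d theta = (C^T D_i^-1 L)^-1 X_i.

    Hence the score is, almost surely, a sum over i of linear functions of the
    counts Y_i.  Each of them is centered because the last row of C^T D_i^-1 L
    is the all-ones row and the last row of X_i vanishes.  The multinomial
    covariances are obtained by size-biasing, cross terms vanish by
    independence, and what remains is sum_i n_i X_i^T (u_st(pi_i)) X_i, which is
    H U H^T written without blocks. *)

(** * Moments of the multinomial distribution *)

Section MultinomialMoments.
Context {R : realType} {K B : nat}.
Implicit Types (q : 'cV[R]_(K + 1)) (y : (K + 1).-tuple nat).
Implicit Types (o : {ffun 'I_(K + 1) -> 'I_B.+1}).

(** Counts bounded by [B] form a finite type, so the expectations below become finite sums over
    [o]. *)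
Definition count_tuple o : (K + 1).-tuple nat :=
  [tuple (o c : nat) | c < (K + 1)%N].

Definition incr_tuple (c : 'I_(K + 1)) y : (K + 1).-tuple nat :=
  [tuple (tnth y b + (b == c))%N | b < (K + 1)%N].

Definition lin_count (g : 'I_(K + 1) -> R) y : R :=
  \sum_c g c * (tnth y c)%:R.

Lemma sum_incr_tuple c y :
  (\sum_b tnth (incr_tuple c y) b = (\sum_b tnth y b).+1)%N.
Proof.
under eq_bigr do rewrite tnth_mktuple.
rewrite big_split /= (bigD1 c (F := fun b => (b == c) : nat)) //= eqxx.
rewrite [X in (_ + (_ + X))%N]big1; last by move=> b /negbTE ->.
by rewrite addn0 [LHS]addn1.
Qed.

Lemma lin_count_incr g c y : lin_count g (incr_tuple c y) = lin_count g y + g c.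
Proof.
rewrite /lin_count; under eq_bigr do rewrite tnth_mktuple natrD mulrDr.
rewrite big_split /=; congr (_ + _).
rewrite (bigD1 c) //= eqxx mulr1 big1 ?addr0 // => b /negbTE ->.
by rewrite mulr0.
Qed.

(** Size-biasing term by term: the factor $y_c + 1$ cancels in $(y_c + 1)!$, leaving $N + 1$ from
    $(N + 1)!$ and one extra $q_c$. If $y$ does not sum to $N$, both sides are zero. *)
Lemma multinomial_pmf_incr N q c y :
  multinomial_pmf N.+1 q (incr_tuple c y) * (tnth (incr_tuple c y) c)%:R =
  N.+1%:R * q c 0 * multinomial_pmf N q y.
Proof.
rewrite /multinomial_pmf sum_incr_tuple eqSS; case: ifP => _; last first.
  by rewrite mul0r mulr0.
have cond b : b != c -> tnth (incr_tuple c y) b = tnth y b.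
  by move=> /negbTE bc; rewrite tnth_mktuple bc addn0.
have cc : tnth (incr_tuple c y) c = (tnth y c).+1.
  by rewrite tnth_mktuple eqxx; exact: addn1.
have -> : \prod_b (tnth (incr_tuple c y) b)`!%:R =
    (tnth y c).+1%:R * \prod_b (tnth y b)`!%:R :> R.
  rewrite (bigD1 c) //= [in RHS](bigD1 c) //= cc factS natrM.
  by rewrite -mulrA; do 2!congr (_ * _); apply: eq_bigr => b /cond ->.
have -> : \prod_b q b 0 ^+ tnth (incr_tuple c y) b =
    q c 0 * \prod_b q b 0 ^+ tnth y b.
  rewrite (bigD1 c) //= [in RHS](bigD1 c) //= cc exprS.
  by rewrite -mulrA; do 2!congr (_ * _); apply: eq_bigr => b /cond ->.
rewrite cc factS natrM.
set A := \prod_b (tnth y b)`!%:R.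
have A0 : A != 0 by apply/prodf_neq0 => b _; rewrite pnatr_eq0 -lt0n fact_gt0.
have S0 : (tnth y c).+1%:R != 0 :> R by rewrite pnatr_eq0.
field.
by rewrite A0 nat1r S0.
Qed.

Lemma sum_multinomial_pmf0 q (f : (K + 1).-tuple nat -> R) :
  \sum_o multinomial_pmf 0 q (count_tuple o) * f (count_tuple o) =
  f [tuple 0%N | c < (K + 1)%N].
Proof.
have E : count_tuple [ffun=> ord0] = [tuple 0%N | c < (K + 1)%N].
  by apply: eq_from_tnth => c; rewrite !tnth_mktuple ffunE.
rewrite (bigD1 [ffun=> ord0]) //= E big1 => [|o o0]; last first.
  rewrite /multinomial_pmf; case: ifPn => [|_]; last by rewrite mul0r.
  rewrite sum_nat_eq0 => /forallP o0'; case/eqP: o0; apply/ffunP => c.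
  apply: val_inj; rewrite ffunE /=.
  by have /eqP := o0' c; rewrite tnth_mktuple.
rewrite addr0 /multinomial_pmf.
rewrite big1 ?eqxx; last by move=> c _; rewrite tnth_mktuple.
rewrite !big1 ?fact0 ?divr1 ?mulr1 ?mul1r // => c _.
  by rewrite tnth_mktuple expr0.
by rewrite tnth_mktuple.
Qed.

(* Size-biasing: y_c times the weight of y among N + 1 trials is (N + 1) q_c
   times the weight of y - e_c among N trials. *)
Lemma multinomial_size_bias N q c (f : (K + 1).-tuple nat -> R) : (N < B)%N ->
  \sum_o multinomial_pmf N.+1 q (count_tuple o) *
    ((tnth (count_tuple o) c)%:R * f (count_tuple o)) =
  N.+1%:R * q c 0 *
    \sum_o multinomial_pmf N q (count_tuple o) * f (incr_tuple c (count_tuple o)).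
Proof.
move=> NB.
pose tot o := (\sum_b tnth (count_tuple o) b)%N.
(* Since [N < B], [inord] truncates nothing in [up o] when [o] has total [N]. There [dn] undoes
   [up], and [up] undoes [dn] as soon as category [c] is nonempty; the terms where it is empty
   vanish. *)
pose up o : {ffun 'I_(K + 1) -> 'I_B.+1} := [ffun b => inord (o b + (b == c))].
pose dn o : {ffun 'I_(K + 1) -> 'I_B.+1} := [ffun b => inord (o b - (b == c))].
have le_tot o b : (o b <= tot o)%N.
  by rewrite /tot (bigD1 b) //= tnth_mktuple leq_addr.
have up_lt o b : tot o = N -> (o b + (b == c) < B.+1)%N.
  rewrite ltnS => oN; apply: leq_trans NB; rewrite -oN -[(tot o).+1]addn1.
  by rewrite leq_add ?le_tot //; case: eqP.
have count_up o : tot o = N -> count_tuple (up o) = incr_tuple c (count_tuple o).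
  by move=> oN; apply: eq_from_tnth => b; rewrite !tnth_mktuple ffunE inordK ?up_lt.
have dn_lt o b : (o b - (b == c) < B.+1)%N by rewrite (leq_ltn_trans (leq_subr _ _)).
have subK o b : (0 < o c)%N -> (o b - (b == c) + (b == c))%N = o b.
  by move=> oc; case: eqP => [->|]; rewrite ?subnK // subn0 addn0.
have updn o : (0 < o c)%N -> up (dn o) = o.
  by move=> oc; apply/ffunP => b; rewrite !ffunE inordK ?dn_lt // subK // inord_val.
have dnup o : tot o = N -> dn (up o) = o.
  move=> oN; apply/ffunP => b; apply: val_inj; rewrite !ffunE /=.
  by rewrite (inordK (up_lt _ _ oN)) addnK inordK.
have tot_dn o : (0 < o c)%N -> tot o = (tot (dn o)).+1.
  move=> oc; rewrite /tot -(sum_incr_tuple c); apply: eq_bigr => b _.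
  by rewrite !tnth_mktuple ffunE inordK ?dn_lt // subK.
transitivity (\sum_(o | (tot o == N.+1) && (0 < o c)%N)
    multinomial_pmf N.+1 q (count_tuple o) *
      ((tnth (count_tuple o) c)%:R * f (count_tuple o))).
  rewrite [RHS]big_mkcond; apply: eq_bigr => o _; case: ifPn => //.
  rewrite negb_and => /orP[/negbTE oN|].
    by rewrite /multinomial_pmf -/(tot o) oN mul0r.
  by rewrite -eqn0Ngt tnth_mktuple => /eqP ->; rewrite mul0r mulr0.
rewrite (reindex_onto up dn) /=; last by move=> o /andP[_ /updn].
transitivity (\sum_(o | tot o == N)
    multinomial_pmf N.+1 q (count_tuple (up o)) *
      ((tnth (count_tuple (up o)) c)%:R * f (count_tuple (up o)))).
  apply: eq_bigl => o; apply/idP/idP => [/andP[/andP[/eqP tN uc] /eqP du]|/eqP oN].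
    by rewrite -eqSS -{1}du -tot_dn // tN.
  have uc : (0 < up o c)%N by rewrite ffunE inordK ?up_lt // eqxx addn_gt0 orbT.
  by rewrite dnup // uc !eqxx !andbT /tot count_up // sum_incr_tuple -/(tot o) oN.
rewrite mulr_sumr [LHS]big_mkcond; apply: eq_bigr => o _; case: ifPn => [/eqP oN|oN].
  by rewrite count_up // mulrA multinomial_pmf_incr mulrA.
by rewrite /multinomial_pmf -/(tot o) (negbTE oN) mul0r mulr0.
Qed.

(** Sum size-biasing with [f = 1] over [c]: the counts add up to $N + 1$ on the left and the $q_c$
    to 1 on the right, so the total masses for $N + 1$ and $N$ trials agree. *)
Lemma sum_multinomial_pmf N q : (N <= B)%N -> \sum_c q c 0 = 1 ->
  \sum_o multinomial_pmf N q (count_tuple o) = 1.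
Proof.
move=> + q1; elim: N => [_|N IH NB].
  have := sum_multinomial_pmf0 q (fun=> 1).
  by under eq_bigr do rewrite mulr1.
apply: (@mulfI R N.+1%:R); first by rewrite pnatr_eq0.
transitivity (\sum_c \sum_o multinomial_pmf N.+1 q (count_tuple o) *
    ((tnth (count_tuple o) c)%:R * 1)).
  rewrite exchange_big mulr_sumr; apply: eq_bigr => o _ /=.
  rewrite -mulr_sumr; under [in RHS]eq_bigr do rewrite mulr1.
  rewrite -natr_sum /multinomial_pmf; case: ifP => [/eqP ->|_]; first by rewrite mulrC.
  by rewrite mul0r mulr0.
under eq_bigr do rewrite (multinomial_size_bias _ _ (fun=> 1)) //.
under eq_bigr do rewrite (eq_bigr _ (fun i _ => mulr1 _)) IH 1?ltnW // mulr1.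
by rewrite -mulr_sumr q1.
Qed.

Lemma multinomial_mean N q g : (N <= B)%N -> \sum_c q c 0 = 1 ->
  \sum_o multinomial_pmf N q (count_tuple o) * lin_count g (count_tuple o) =
  N%:R * \sum_c g c * q c 0.
Proof.
case: N => [_ q1|N NB q1].
  rewrite sum_multinomial_pmf0 mul0r; apply: big1 => c _.
  by rewrite tnth_mktuple mulr0.
under eq_bigr do rewrite mulr_sumr.
rewrite exchange_big mulr_sumr; apply: eq_bigr => c _ /=.
transitivity (g c * \sum_o multinomial_pmf N.+1 q (count_tuple o) *
    ((tnth (count_tuple o) c)%:R * 1)).
  by rewrite mulr_sumr; apply: eq_bigr => o _; rewrite mulr1 mulrCA.
rewrite (multinomial_size_bias _ _ (fun=> 1)) //.
by rewrite (eq_bigr _ (fun i _ => mulr1 _)) sum_multinomial_pmf 1?ltnW // mulr1 mulrCA.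
Qed.

(** Size-bias the counts in the first factor. The second factor is shifted by $g'_c$: its unshifted
    part has a mean independent of $c$, which centering of [g] kills, and the shift leaves the
    diagonal sum. *)
Lemma multinomial_cov N q g g' : (N <= B)%N -> \sum_c q c 0 = 1 ->
  \sum_c g c * q c 0 = 0 ->
  \sum_o multinomial_pmf N q (count_tuple o) *
    (lin_count g (count_tuple o) * lin_count g' (count_tuple o)) =
  N%:R * \sum_c g c * g' c * q c 0.
Proof.
case: N => [_ q1 g0|N NB q1 g0].
  rewrite (sum_multinomial_pmf0 q (fun y => lin_count g y * lin_count g' y)) mul0r.
  rewrite {1}/lin_count big1 ?mul0r // => c _.
  by rewrite tnth_mktuple mulr0.
transitivity (\sum_c g c * \sum_o multinomial_pmf N.+1 q (count_tuple o) *
    ((tnth (count_tuple o) c)%:R * lin_count g' (count_tuple o))).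
  under [RHS]eq_bigr do rewrite mulr_sumr.
  rewrite exchange_big; apply: eq_bigr => o _ /=.
  by rewrite mulr_suml mulr_sumr; apply: eq_bigr => c _; rewrite -mulrA mulrCA.
transitivity (\sum_c (N.+1%:R * (N%:R * \sum_b g' b * q b 0) * (g c * q c 0) +
    N.+1%:R * (g c * g' c * q c 0))).
  apply: eq_bigr => c _; rewrite multinomial_size_bias //.
  under eq_bigr do rewrite lin_count_incr mulrDr.
  rewrite big_split /= multinomial_mean 1?ltnW // -mulr_suml.
  by rewrite sum_multinomial_pmf 1?ltnW // mul1r; ring.
by rewrite big_split /= -mulr_sumr g0 mulr0 add0r mulr_sumr.
Qed.

End MultinomialMoments.

(** * The logit equations as a linear system *)

Section LogitSystem.
Context {R : realType} {K : nat}.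
Implicit Types (t : logit_type) (q z : 'cV[R]_(K + 1)).

Lemma unitmx_inj n (A : 'M[R]_n) :
  (forall z : 'cV_n, A *m z = 0 -> z = 0) -> A \in unitmx.
Proof.
move=> A0; rewrite -unitmx_tr -row_free_unit; apply: inj_row_free => v vA.
by apply: trmx_inj; rewrite trmx0; apply: A0; rewrite -[A]trmxK -trmx_mul vA trmx0.
Qed.

Lemma invmx_diag_mul n (w v : 'cV[R]_n) : (forall k, w k 0 != 0) ->
  invmx (diag_mx w^T) *m v = \col_k (v k 0 / w k 0).
Proof.
move=> w0; have U : diag_mx w^T \in unitmx.
  apply: unitmx_inj => z /colP E; apply/colP => k; have := E k.
  rewrite mul_diag_mx !mxE => /eqP; rewrite mulf_eq0 (negbTE (w0 k)) /= => /eqP //.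
rewrite -[RHS](mulKmx U); congr (_ *m _); apply/colP => k.
by rewrite mul_diag_mx !mxE mulrC divfK.
Qed.

Definition nu_mx t : 'M[R]_(K, K + 1) := \matrix_(j, c) (in_nu t j c)%:R.

Definition dl_mx t : 'M[R]_(K, K + 1) := \matrix_(j, c) (@in_delta K t j c)%:R.

Lemma nu_mxE t z j : (nu_mx t *m z) j 0 = \sum_(c < K + 1 | in_nu t j c) z c 0.
Proof.
rewrite mxE [RHS]big_mkcond; apply: eq_bigr => c _.
by rewrite mxE; case: ifP; rewrite ?mul1r ?mul0r.
Qed.

Lemma dl_mxE t z j : (dl_mx t *m z) j 0 = \sum_(c < K + 1 | @in_delta K t j c) z c 0.
Proof.
rewrite mxE [RHS]big_mkcond; apply: eq_bigr => c _.
by rewrite mxE; case: ifP; rewrite ?mul1r ?mul0r.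
Qed.

Lemma ones_mulmx z : (const_mx 1 : 'M[R]_(1, K + 1)) *m z = (\sum_c z c 0)%:M.
Proof.
apply/matrixP => a b; rewrite !ord1 !mxE eqxx mulr1n.
by apply: eq_bigr => c _; rewrite mxE mul1r.
Qed.

Lemma nu_gt0 t q j : (forall c, 0 < q c 0) -> 0 < (nu_mx t *m q) j 0.
Proof.
move=> q0; rewrite nu_mxE (bigD1 (lshift 1 j)) /=; last by case: t => /=.
by rewrite ltr_wpDr // sumr_ge0 // => c _; exact: ltW.
Qed.

Lemma dl_gt0 t q j : (forall c, 0 < q c 0) -> 0 < (dl_mx t *m q) j 0.
Proof.
move=> q0; rewrite dl_mxE.
have [c cP] : exists c : 'I_(K + 1), @in_delta K t j c.
  have jK := ltn_ord j.
  have jK1 : (j.+1 < K + 1)%N by rewrite addn1 ltnS.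
  by case: t; [exists (rshift K ord0) | exists (rshift K ord0) | exists (Ordinal jK1)
    | exists (rshift K ord0)]; rewrite /= ?addn0.
rewrite (bigD1 c) //=.
by rewrite ltr_wpDr // sumr_ge0 // => b _; exact: ltW.
Qed.

(* Unless t is Cumulative, the ratios nu_j / delta_j determine q up to a factor
   by downward induction on the category. *)
Lemma logit_ratios_inj t q z : (forall c, 0 < q c 0) ->
  (forall j, (nu_mx t *m z) j 0 * (dl_mx t *m q) j 0 =
             (nu_mx t *m q) j 0 * (dl_mx t *m z) j 0) ->
  \sum_c z c 0 = 0 -> z = 0.
Proof.
move=> q0 zq z0.
have lt_addS (a b : nat) : (a < a + b.+1)%N by rewrite addnS ltnS leq_addr.
have le_addS (a b e : nat) : (a < e)%N -> (a + b.+1 <= e + b)%N.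
  by move=> ae; rewrite addnS -addSn leq_add2r.
have leK (c : 'I_(K + 1)) : (c <= K)%N by rewrite -ltnS -[K.+1]addn1.
(* Triangular case: nu_j is the single category j and delta_j involves only later ones. Subtracting
   the multiple [l] of [q] that matches [z] in the last category leaves [u], which vanishes by
   downward induction; then [z = l *: q] has mass zero, so [l = 0]. *)
have tri (nuE : forall (j : 'I_K) (c : 'I_(K + 1)), in_nu t j c = (c == lshift 1 j))
    (dlP : forall (j : 'I_K) (c : 'I_(K + 1)), @in_delta K t j c -> (j < c)%N) : z = 0.
  pose last : 'I_(K + 1) := rshift K ord0.
  pose l := z last 0 / q last 0; pose u := z - l *: q.
  have uq j : (nu_mx t *m u) j 0 * (dl_mx t *m q) j 0 =
      (nu_mx t *m q) j 0 * (dl_mx t *m u) j 0.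
    rewrite /u !mulmxBr -!scalemxAr; have := zq j.
    set a := nu_mx t *m z; set b := dl_mx t *m q; set c := nu_mx t *m q.
    by set d := dl_mx t *m z; rewrite !mxE mulrBl mulrBr => ->; ring.
  have u0 k : forall c : 'I_(K + 1), (K <= c + k)%N -> u c 0 = 0.
    elim: k => [|k IH] c; first rewrite addn0 => Kc.
      have -> : c = last.
        by apply: val_inj; apply/eqP; rewrite eqn_leq /= addn0 Kc leK.
      by rewrite !mxE divfK ?subrr // gt_eqF.
    rewrite leq_eqVlt => /orP[/eqP Kc|]; last by rewrite addnS ltnS => /IH.
    have cK : (c < K)%N.
      by apply: (@leq_trans (c + k.+1)); [exact: lt_addS | rewrite -Kc].
    have cE : c = lshift 1 (Ordinal cK) by apply: val_inj.
    have := uq (Ordinal cK); rewrite nu_mxE (big_pred1 c) => [|b]; last first.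
      by rewrite nuE /= -cE.
    rewrite [X in _ = _ * X]dl_mxE [X in _ = _ * X]big1 => [|b /dlP /= cb]; last first.
      apply: IH; apply: (@leq_trans (c + k.+1)); first by rewrite -Kc.
      exact: le_addS.
    by rewrite mulr0 => /eqP; rewrite mulf_eq0 (gt_eqF (dl_gt0 _ _ q0)) orbF => /eqP.
  have zE : z = l *: q.
    apply/eqP; rewrite -subr_eq0; apply/eqP/colP => c; rewrite [RHS]mxE.
    by apply: (u0 K); rewrite leq_addl.
  have : l * \sum_c q c 0 = 0.
    rewrite -[RHS]z0 mulr_sumr; apply: eq_bigr => c _.
    by rewrite zE [RHS]mxE.
  move/eqP; rewrite mulf_eq0 [X in _ || X]gt_eqF ?orbF => [/eqP l0|].
    by rewrite zE l0 scale0r.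
  rewrite (bigD1 last) //= ltr_wpDr // sumr_ge0 // => b _; exact: ltW.
case: t zq tri => zq tri; last 2 first.
- by apply: tri => j c //= /eqP ->.
- exact: tri.
- by apply: tri => j c //= /eqP ->; exact: ltn_ord.
  (* For cumulative logits nu_j + delta_j is the total mass. As [z] has mass zero, its delta_j is
     minus its nu_j, and the ratio equation reads nu_j(z) times the mass of [q] equals 0. All
     partial sums of [z] then vanish, hence so do its entries. *)
  have nu0 j : (nu_mx Defs.Cumulative *m z) j 0 = 0.
    have split (w : 'cV_(K + 1)) :
        (nu_mx Defs.Cumulative *m w) j 0 + (dl_mx Defs.Cumulative *m w) j 0 =
        \sum_c w c 0.
      rewrite nu_mxE dl_mxE [RHS](bigID (fun c : 'I_(K + 1) => (c <= j)%N)) /=.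
      by congr (_ + _); apply: eq_bigl => c; rewrite ltnNge.
    have /eqP := split z; rewrite z0 addr_eq0 => /eqP nz.
    have /eqP := zq j; rewrite nz mulNr eq_sym -addr_eq0 [X in _ + X]mulrC -mulrDl split.
    have q1 : 0 < \sum_c q c 0 by rewrite -(split q) addr_gt0 ?nu_gt0 ?dl_gt0.
    by rewrite mulf_eq0 gt_eqF //= => /eqP ->; rewrite oppr0.
  have part0 (c : 'I_(K + 1)) : \sum_(b < K + 1 | (b <= c)%N) z b 0 = 0.
    have [cK|Kc] := ltnP c K; first by have := nu0 (Ordinal cK); rewrite nu_mxE.
    by rewrite -[RHS]z0; apply: eq_bigl => b; rewrite (leq_trans (leK b)).
  suff zz k : forall c : 'I_(K + 1), (c < k)%N -> z c 0 = 0.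
    by apply/colP => c; rewrite [RHS]mxE; apply: (zz (K + 1)).
  elim: k => // k IH c; rewrite ltnS => ck.
  have := part0 c; rewrite (bigD1 c) //= big1 ?addr0 // => b /andP[bc bNc].
  apply: IH; apply: leq_trans ck.
  by rewrite ltn_neqAle bc andbT.
Qed.

Lemma CTmx_mul (y : 'cV[R]_(K + K + 1)) :
  CTmx *m y = col_mx (usubmx (usubmx y) - dsubmx (usubmx y)) (dsubmx y).
Proof.
rewrite -{1}[y]vsubmxK -{1}[usubmx y]vsubmxK mul_block_col mul_row_col.
by rewrite !mul1mx mulNmx mul1mx mul0mx addr0 mul0mx add0r.
Qed.

Lemma Lmx_mul t z :
  Lmx t *m z = col_mx (col_mx (nu_mx t *m z) (dl_mx t *m z)) (\sum_c z c 0)%:M.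
Proof. by rewrite /Lmx !mul_col_mx ones_mulmx. Qed.

Lemma Lmx_gt0 t q k : (forall c, 0 < q c 0) -> 0 < (Lmx t *m q) k 0.
Proof.
move=> q0; rewrite Lmx_mul mxE; case: splitP => [k' _|k' _].
  by rewrite mxE; case: splitP => j _; [exact: nu_gt0 | exact: dl_gt0].
rewrite ord1 mxE eqxx mulr1n (bigD1 (rshift K ord0)) //= ltr_wpDr //.
by rewrite sumr_ge0 // => b _; exact: ltW.
Qed.

(** The right-hand side is the derivative of $C^T \log(L q)$ in the direction [z]: a difference of
    logarithmic derivatives for each logit, and one for the total mass. *)
Lemma CDLmx_mul t q z : (forall c, 0 < q c 0) ->
  CDLmx t q *m z =
  col_mx (\col_j ((nu_mx t *m z) j 0 / (nu_mx t *m q) j 0 -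
                  (dl_mx t *m z) j 0 / (dl_mx t *m q) j 0))
         ((\sum_c z c 0) / (\sum_c q c 0))%:M.
Proof.
move=> q0; rewrite /CDLmx -!mulmxA invmx_diag_mul => [|k]; last first.
  by rewrite gt_eqF // Lmx_gt0.
rewrite CTmx_mul !Lmx_mul; congr col_mx; apply/colP => j.
  rewrite [LHS]mxE [X in _ + X]mxE [RHS]mxE; congr (_ - _).
    by rewrite [LHS]mxE [LHS]mxE [LHS]mxE !col_mxEu.
  by rewrite [LHS]mxE [LHS]mxE [LHS]mxE !col_mxEu !col_mxEd.
by rewrite [LHS]mxE [LHS]mxE !col_mxEd !mxE ord1 eqxx !mulr1n.
Qed.

(** A kernel vector has mass zero and the same ratios nu_j : delta_j as [q], so [logit_ratios_inj]
    applies. *)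
Lemma CDLmx_unit t q : (forall c, 0 < q c 0) -> CDLmx t q \in unitmx.
Proof.
move=> q0; apply: unitmx_inj => z; rewrite CDLmx_mul // => E.
have := congr1 usubmx E; have := congr1 dsubmx E.
rewrite col_mxKd col_mxKu linear0 [X in _ -> X = _ -> _]lock linear0 -lock => z0 nz.
have q1 : \sum_c q c 0 != 0.
  have := Lmx_gt0 t (rshift (K + K) ord0) q0.
  by rewrite Lmx_mul col_mxEd mxE eqxx mulr1n => /gt_eqF ->.
apply: (logit_ratios_inj (t := t) q0) => [j|].
  have /colP/(_ j)/eqP := nz; rewrite mxE [X in _ == X]mxE subr_eq0.
  rewrite eqr_div ?(gt_eqF (nu_gt0 _ _ q0)) ?(gt_eqF (dl_gt0 _ _ q0)) //.
  by move/eqP => ->; rewrite mulrC.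
have /matrixP/(_ ord0 ord0)/eqP := z0; rewrite !mxE eqxx mulr1n mulf_eq0 invr_eq0.
by rewrite (negbTE q1) orbF => /eqP.
Qed.

(** The matrix A(eta): exponentiating log(nu_j / delta_j) = eta_j gives nu_j - exp(eta_j) delta_j =
    0, linear in the cell probabilities. The last row is the total mass. *)
Definition sys_mx t (eta : 'cV[R]_K) : 'M[R]_(K + 1) :=
  col_mx (\matrix_(j, c) ((in_nu t j c)%:R - expR (eta j 0) * (@in_delta K t j c)%:R))
         (const_mx 1).

Lemma sys_mx_mul t eta z :
  sys_mx t eta *m z =
  col_mx (\col_j ((nu_mx t *m z) j 0 - expR (eta j 0) * (dl_mx t *m z) j 0))
         (\sum_c z c 0)%:M.
Proof.
rewrite /sys_mx mul_col_mx ones_mulmx; congr col_mx; apply/colP => j.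
rewrite !mxE mulr_sumr -sumrB; apply: eq_bigr => c _.
by rewrite !mxE mulrBl mulrA.
Qed.

Definition sys_rhs : 'cV[R]_(K + 1) := col_mx 0 1%:M.

Lemma sys_mxP t eta q :
  sys_mx t eta *m q = sys_rhs <->
  (forall j, (nu_mx t *m q) j 0 = expR (eta j 0) * (dl_mx t *m q) j 0) /\
  \sum_c q c 0 = 1.
Proof.
rewrite sys_mx_mul; split=> [E|[E1 E2]].
  split=> [j|].
    have /(congr1 usubmx)/colP/(_ j)/eqP := E; rewrite !col_mxKu.
    by rewrite mxE [X in _ == X]mxE subr_eq0 => /eqP.
  have /(congr1 dsubmx)/matrixP/(_ ord0 ord0) := E.
  by rewrite !col_mxKd !mxE eqxx !mulr1n.
by rewrite E2; congr col_mx; apply/colP => j; rewrite mxE E1 subrr mxE.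
Qed.

(** The positive solution expresses exp(eta_j) as nu_j(q) / delta_j(q), which turns the kernel
    equations into those of [logit_ratios_inj]. *)
Lemma sys_mx_unit t eta q : (forall c, 0 < q c 0) -> sys_mx t eta *m q = sys_rhs ->
  sys_mx t eta \in unitmx.
Proof.
move=> q0 /sys_mxP[qE _]; apply: unitmx_inj => z; rewrite sys_mx_mul => E.
apply: (logit_ratios_inj (t := t) q0) => [j|].
  have /(congr1 usubmx)/colP/(_ j)/eqP := E; rewrite col_mxKu linear0.
  by rewrite mxE [X in _ == X]mxE subr_eq0 => /eqP ->; rewrite qE; ring.
have /(congr1 dsubmx)/matrixP/(_ ord0 ord0) := E.
by rewrite col_mxKd linear0 !mxE eqxx mulr1n.
Qed.

Section CellProb.
Context {p : nat} (t : logit_type) (X : 'M[R]_(K, p)).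

(** Here [X] is the model matrix without its zero last row; that row encodes ln of the total mass
    being 0. *)
Lemma is_cell_probP (theta : 'cV_p) q :
  is_cell_prob t (col_mx X 0) theta q <->
  (forall c, 0 < q c 0) /\ sys_mx t (X *m theta) *m q = sys_rhs.
Proof.
rewrite /is_cell_prob CTmx_mul Lmx_mul mul_col_mx mul0mx; split.
  move=> [q0 q1 E]; split=> //; apply/sys_mxP; split=> // j.
  have : ln ((nu_mx t *m q) j 0) - ln ((dl_mx t *m q) j 0) = (X *m theta) j 0.
    have /(congr1 usubmx)/colP/(_ j) := E; rewrite !map_col_mx !col_mxKu col_mxKd => <-.
    rewrite [RHS]mxE [X in _ = _ + X]mxE [X in _ = X - _]mxE.
    by rewrite [X in _ = _ - X]mxE.
  move/eqP; rewrite subr_eq => /eqP E'; rewrite -[LHS]lnK ?posrE ?nu_gt0 // E' expRD.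
  by rewrite lnK ?posrE ?dl_gt0.
move=> [q0 /sys_mxP[E q1]]; split=> //.
rewrite !map_col_mx col_mxKu !col_mxKd col_mxKu q1; congr col_mx.
  apply/colP => j; rewrite mxE [X in X + _]mxE E lnM ?posrE ?expR_gt0 ?dl_gt0 //.
  by rewrite expRK [X in _ + X]mxE [X in _ - X]mxE addrK.
by apply/matrixP => a b; rewrite !ord1 !mxE eqxx mulr1n ln1.
Qed.

(** Invertibility of the system makes the positive solution unique, so the value chosen by [xget]
    must be [q]. *)
Lemma cell_probE (theta : 'cV_p) q :
  (forall c, 0 < q c 0) -> sys_mx t (X *m theta) *m q = sys_rhs ->
  cell_prob t (col_mx X 0) theta = q.
Proof.
move=> q0 E; have S : is_cell_prob t (col_mx X 0) theta q by apply/is_cell_probP.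
have : is_cell_prob t (col_mx X 0) theta (cell_prob t (col_mx X 0) theta).
  by rewrite /cell_prob; exact: xgetPex (ex_intro _ q S).
move=> /is_cell_probP[_ E']; have U := sys_mx_unit q0 E.
by rewrite -[LHS](mulKmx U) E' -E mulKmx.
Qed.

End CellProb.

End LogitSystem.

(** * Differentiating the cell probabilities *)

Section LineDerivatives.
Context {R : realType}.

(** Reduces every directional derivative to one-variable calculus at 0. *)
Lemma derive_line (V W : normedModType R) (f : V -> W) (a v : V) :
  'D_v f a = 'D_1 (fun s : R => f (s *: v + a)) 0.
Proof.
apply: (congr1 (fun g : R -> W => lim (g @ 0^'))); apply/funext => s /=.
by rewrite scale0r add0r addr0 [s *: 1]mulr1.
Qed.

Lemma is_derive_fsum (I : Type) (r : seq I) (Q : pred I) (F : I -> R -> R)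
    (dF : I -> R) (x : R) :
  (forall i, Q i -> is_derive x 1 (F i) (dF i)) ->
  is_derive x 1 (fun s => \sum_(i <- r | Q i) F i s) (\sum_(i <- r | Q i) dF i).
Proof.
move=> dFi; elim: r => [|i r IH].
  rewrite big_nil; under eq_fun do rewrite big_nil; exact: is_derive_cst.
rewrite big_cons; under eq_fun do rewrite big_cons.
by case: ifPn => // /dFi ?; exact: is_deriveD.
Qed.

Lemma derivable_fsum (I : Type) (r : seq I) (Q : pred I) (F : I -> R -> R) (x : R) :
  (forall i, Q i -> derivable (F i) x 1) ->
  derivable (fun s => \sum_(i <- r | Q i) F i s) x 1.
Proof.
move=> dF; apply: ex_derive; apply: is_derive_fsum => i /dF; exact: derivableP.
Qed.

Lemma derivable_fprod (I : Type) (r : seq I) (F : I -> R -> R) (x : R) :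
  (forall i, derivable (F i) x 1) ->
  derivable (fun s => \prod_(i <- r) F i s) x 1.
Proof.
move=> dFi; elim: r => [|i r IH].
  under eq_fun do rewrite big_nil; exact: derivable_cst.
under eq_fun do rewrite big_cons; exact: derivableM.
Qed.

Lemma derivable_det n (M : R -> 'M[R]_n) (x : R) :
  (forall i j, derivable (fun s => M s i j) x 1) ->
  derivable (fun s => \det (M s)) x 1.
Proof.
move=> dM; apply: derivable_fsum => sg _; apply: derivableM.
  exact: derivable_cst.
exact: derivable_fprod.
Qed.

Lemma derivable_adj n (M : R -> 'M[R]_n) (x : R) i j :
  (forall i j, derivable (fun s => M s i j) x 1) ->
  derivable (fun s => (\adj (M s)) i j) x 1.
Proof.
move=> dM; under eq_fun do rewrite mxE.
apply: derivableM; first exact: derivable_cst.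
apply: derivable_det => a b; under eq_fun do rewrite !mxE.
exact: dM.
Qed.

Lemma is_derive_ln (f : R -> R) (x df : R) : 0 < f x -> is_derive x 1 f df ->
  is_derive x 1 (fun s => ln (f s)) (df / f x).
Proof.
move=> fx0 dfx; have dln := is_derive1_ln fx0.
have dc : is_derive x 1 (@ln R \o f) ((f x)^-1 * df) by exact: is_derive1_comp.
by rewrite mulrC.
Qed.

Lemma is_derive_affine (a b x : R) : is_derive x 1 (fun s => s * a + b) a.
Proof.
have -> : (fun s => s * a + b) = a \*: (id : R -> R) + cst b.
  by apply/funext => s; rewrite mulrC.
by apply: is_derive_eq; rewrite addr0 [_ *: _]mulr1.
Qed.

Lemma derivable_gt0 (f : R -> R) (x : R) : derivable f x 1 -> 0 < f x ->
  \forall s \near x, 0 < f s.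
Proof.
move=> /derivable1_diffP/differentiable_continuous cf fx.
exact: (cf _ (lt_nbhsr fx)).
Qed.

Lemma derivable_neq0 (f : R -> R) (x : R) : derivable f x 1 -> f x != 0 ->
  \forall s \near x, f s != 0.
Proof.
move=> df fx; have d2 : derivable (f * f) x 1 by exact: derivableM.
have ff0 : 0 < (f * f) x by rewrite -[X in _ < X]/(f x * f x) -expr2 exprn_even_gt0.
apply: filterS (derivable_gt0 d2 ff0) => s; apply: contraTneq => fs.
by rewrite -[X in _ < X]/(f s * f s) fs mulr0 ltxx.
Qed.

End LineDerivatives.

Section CellProbDerivative.
Context {R : realType} {K p : nat} (t : logit_type) (X : 'M[R]_(K, p)).
Context (theta v : 'cV[R]_p).
Hypothesis feas : exists q, is_cell_prob t (col_mx X 0) theta q.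

Local Notation prob s := (cell_prob t (col_mx X 0) (s *: v + theta)).

Lemma cell_prob_ok : is_cell_prob t (col_mx X 0) theta (cell_prob t (col_mx X 0) theta).
Proof. exact: xgetPex feas. Qed.

Let q := cell_prob t (col_mx X 0) theta.

Let A (s : R) := sys_mx t (X *m (s *: v + theta)).

(* Cramer's rule makes the solution of the linear system a differentiable
   function of s. *)
Lemma near_cell_prob :
  (\forall s \near (0 : R), is_cell_prob t (col_mx X 0) (s *: v + theta) (prob s)) /\
  (forall c, derivable (fun s : R => prob s c 0) 0 1).
Proof.
have /is_cell_probP[q0 Aq] := cell_prob_ok; rewrite -/q in q0 Aq.
have A0 : A 0 = sys_mx t (X *m theta) by rewrite /A scale0r add0r.
have AU := sys_mx_unit q0 Aq.
have dA i j : derivable (fun s => A s i j) 0 1.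
  rewrite /A /sys_mx; case: (split_ordP i) => k ->.
    under eq_fun do rewrite col_mxEu mxE.
    apply: derivableB; first exact: derivable_cst.
    apply: derivableM; last exact: derivable_cst.
    have dlin : derivable (fun s : R => (X *m (s *: v + theta)) k 0) 0 1.
      under eq_fun do rewrite mulmxDr -scalemxAr mxE [X in X + _]mxE.
      by apply: derivableD => //; exact: derivableM.
    apply/derivable1_diffP; apply: differentiable_comp; first exact/derivable1_diffP.
    by apply/derivable1_diffP; exact: derivable_expR.
  by under eq_fun do rewrite col_mxEd mxE; exact: derivable_cst.
(* The Cramer solution, defined for every [s] and solving the system wherever the determinant is
   nonzero. Near 0 the determinant stays nonzero and the entries positive, so [cell_probE]
   identifies it with [cell_prob]. *)
pose w (s : R) := (\det (A s))^-1 *: (\adj (A s) *m (sys_rhs : 'cV_(K + 1))).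
have wE s : \det (A s) != 0 -> A s *m w s = sys_rhs.
  move=> d0; rewrite /w -scalemxAr mulmxA mul_mx_adj mul_scalar_mx scalerA.
  by rewrite mulVf // scale1r.
have det0 : \det (A 0) != 0 by rewrite A0 -unitfE -unitmxE.
have w0 : w 0 = q.
  by rewrite -(mulKmx AU (w 0)) -A0 wE // A0 -Aq mulKmx.
have dw c : derivable (fun s => w s c 0) 0 1.
  under eq_fun do rewrite /w !mxE.
  apply: derivableM; first by apply: derivableV => //; exact: derivable_det.
  apply: derivable_fsum => j _; apply: derivableM; last exact: derivable_cst.
  exact: derivable_adj.
have near_w : \forall s \near (0 : R), prob s = w s /\
    is_cell_prob t (col_mx X 0) (s *: v + theta) (prob s).
  have dn := derivable_neq0 (derivable_det dA) det0.
  have wn : \forall s \near (0 : R), forall c, 0 < w s c 0.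
    apply: (@filter_forall R _ (fun c s => 0 < w s c 0) (nbhs (0 : R))) => c.
    by apply: derivable_gt0 => //; rewrite w0.
  near=> s; have ds : \det (A s) != 0 by near: s.
  have ws c : 0 < w s c 0 by move: c; near: s.
  have -> : prob s = w s by apply: cell_probE => //; exact: wE.
  by split=> //; apply/is_cell_probP; split=> //; exact: wE.
split; first by apply: filterS near_w => s [].
move=> c; apply: near_eq_derivable (dw c).
by apply: filterS near_w => s [-> _].
Unshelve. all: by end_near. Qed.

Lemma is_derive_cell_prob c :
  is_derive (0 : R) 1 (fun s => prob s c 0)
    ((invmx (CDLmx t q) *m (col_mx X 0 *m v)) c 0).
Proof.
have [np dp] := near_cell_prob.
have /is_cell_probP[q0 Aq] := cell_prob_ok; rewrite -/q in q0 Aq.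
have /sys_mxP[_ q1] := Aq.
have p0 : prob 0 = q by rewrite scale0r add0r.
pose dw : 'cV[R]_(K + 1) := \col_b 'D_1 (fun s : R => prob s b 0) 0.
have dpE b : is_derive (0 : R) 1 (fun s : R => prob s b 0) (dw b 0).
  by rewrite mxE; exact: derivableP.
(* The upper rows compare the derivative of ln nu_j - ln delta_j with that of the linear predictor,
   equal to it near 0; the last row differentiates the constant total mass. *)
suff E : CDLmx t q *m dw = col_mx X 0 *m v.
  by rewrite -E mulKmx ?CDLmx_unit.
have dmul n (M : 'M[R]_(n, K + 1)) j :
    is_derive (0 : R) 1 (fun s => (M *m prob s) j 0) ((M *m dw) j 0).
  rewrite mxE; under eq_fun do rewrite mxE.
  apply: is_derive_fsum => b _; exact: (is_deriveZ (M j b) (dpE b)).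
rewrite CDLmx_mul // mul_col_mx mul0mx; congr col_mx; last first.
  suff -> : \sum_b dw b 0 = 0.
    by rewrite mul0r; apply/matrixP => a b; rewrite !mxE mul0rn.
  have d1 := is_derive_fsum (index_enum _) (Q := xpredT) (fun b _ => dpE b).
  rewrite -(derive_val (is_derive := d1)).
  rewrite -[RHS](derive_cst (1 : R) (0 : R) 1); apply: near_eq_derive.
  by apply: filterS np => s [].
apply/colP => j; rewrite mxE.
have dn := is_derive_ln (_ : 0 < (nu_mx t *m prob 0) j 0) (dmul _ (nu_mx t) j).
have dd := is_derive_ln (_ : 0 < (dl_mx t *m prob 0) j 0) (dmul _ (dl_mx t) j).
rewrite p0 in dn dd.
have dB := is_deriveB (dn (nu_gt0 t j q0)) (dd (dl_gt0 t j q0)).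
rewrite -(derive_val (is_derive := dB)).
have dlin : is_derive (0 : R) 1 (fun s : R => (X *m (s *: v + theta)) j 0) ((X *m v) j 0).
  under eq_fun do rewrite mulmxDr -scalemxAr mxE [X in X + _]mxE.
  exact: is_derive_affine.
rewrite -(derive_val (is_derive := dlin)); apply: near_eq_derive.
apply: filterS np => s /is_cell_probP[s0 /sys_mxP[sE _]].
rewrite !fctE sE lnM ?posrE ?expR_gt0 ?dl_gt0 // expRK addrK //.
Qed.

End CellProbDerivative.

(** * The score and its law *)

Section Score.
Context {R : realType} {K m p : nat} (t : logit_type) (n : 'I_m -> nat).
Context (X : 'I_m -> 'M[R]_(K, p)) (theta : 'cV[R]_p).
Hypothesis feas : feasible t (fun i => col_mx (X i) 0) theta.

Lemma ln_prod (I : Type) (r : seq I) (Q : pred I) (F : I -> R) :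
  (forall i, 0 < F i) ->
  ln (\prod_(i <- r | Q i) F i) = \sum_(i <- r | Q i) ln (F i).
Proof.
move=> F0; elim: r => [|i r IH]; first by rewrite !big_nil ln1.
rewrite !big_cons; case: ifP => // _.
by rewrite lnM ?posrE ?prodr_gt0 // IH.
Qed.

(** The count vectors at which the likelihood does not vanish identically. *)
Definition valid_counts (y : 'I_m -> (K + 1).-tuple nat) : bool :=
  [forall i, (0 < n i)%N ==> (\sum_c tnth (y i) c == n i)%N].

(** The partial derivative of $\log \pi_{ic}$ with respect to the a-th parameter. *)
Definition score_coef (a : 'I_p) (i : 'I_m) (c : 'I_(K + 1)) : R :=
  let q := cell_prob t (col_mx (X i) 0) theta in
  (invmx (CDLmx t q) *m (col_mx (X i) 0 *m (delta_mx a 0 : 'cV_p))) c 0 / q c 0.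

Lemma scoreE y a :
  score t n (fun i => col_mx (X i) 0) theta y a =
  if valid_counts y then
    \sum_(i < m | (0 < n i)%N) lin_count (score_coef a i) (y i)
  else 0.
Proof.
rewrite /score derive_line; set v := delta_mx a 0.
case: ifPn => [/forallP yn|]; last first.
  rewrite negb_forall => /existsP[i]; rewrite negb_imply => /andP[ni yi].
  (* A setting whose counts have the wrong total makes the likelihood zero for all parameters, so
     [loglik] is the constant [ln 0]. *)
  transitivity ('D_1 (cst (ln 0)) (0 : R)); last exact: derive_cst.
  apply: (congr1 (fun f : R -> R => 'D_1 f (0 : R))).
  apply/funext => s; rewrite /loglik (bigD1 i) //= /multinomial_pmf (negbTE yi).
  by rewrite mul0r.
pose q i s := cell_prob t (col_mx (X i) 0) (s *: v + theta).
pose C i : R := (n i)`!%:R / \prod_c (tnth (y i) c)`!%:R.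
have C0 i : 0 < C i.
  by rewrite divr_gt0 ?prodr_gt0 // => *; rewrite ltr0n fact_gt0.
(* Splitting the logarithm needs positive cell probabilities, hence agrees with [loglik] only near
   0; that suffices for the derivative, in which the multinomial coefficients [C i] drop out. *)
pose L (s : R) := \sum_(i < m | (0 < n i)%N)
  (ln (C i) + \sum_c (tnth (y i) c)%:R * ln (q i s c 0)).
have near_L : \forall s \near (0 : R),
    loglik t n (fun i => col_mx (X i) 0) y (s *: v + theta) = L s.
  have nq : \forall s \near (0 : R), forall i c, 0 < q i s c 0.
    apply: (@filter_forall R _ (fun i s => forall c, 0 < q i s c 0) (nbhs (0 : R))) => i.
    by have [+ _] := near_cell_prob v (feas i); apply: filterS => s [].
  apply: filterS nq => s q0; rewrite /loglik.
  transitivity (ln (\prod_(i < m | (0 < n i)%N)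
      (C i * \prod_c q i s c 0 ^+ tnth (y i) c))).
    congr ln; apply: eq_bigr => i ni; rewrite /multinomial_pmf.
    by rewrite (implyP (yn i) ni).
  have qy0 i c : 0 < q i s c 0 ^+ tnth (y i) c by rewrite exprn_gt0.
  rewrite ln_prod => [|i]; last by rewrite mulr_gt0 // prodr_gt0.
  apply: eq_bigr => i _; rewrite lnM ?posrE ?prodr_gt0 // ln_prod //.
  by congr (_ + _); apply: eq_bigr => c _; rewrite lnXn // mulr_natl.
rewrite (near_eq_derive _ near_L).
have q0 i c : 0 < q i 0 c 0.
  by rewrite /q scale0r add0r; have [] := cell_prob_ok (feas i).
have dL : is_derive (0 : R) 1 L
    (\sum_(i < m | (0 < n i)%N) lin_count (score_coef a i) (y i)).
  apply: is_derive_fsum => i _; rewrite -[X in is_derive _ _ _ X]add0r.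
  apply: is_deriveD; apply: is_derive_fsum => c _.
  have := is_deriveZ (tnth (y i) c)%:R
    (is_derive_ln (q0 i c) (is_derive_cell_prob v (feas i) c)).
  rewrite (_ : 0 *: v + theta = theta) ?scale0r ?add0r // => dq.
  by apply: is_derive_eq dq _; rewrite [RHS]mulrC.
exact: (derive_val (is_derive := dL)).
Qed.

End Score.

(** * Expectations of functions of the counts as finite sums *)

Section Expectation.
Context {R : realType} {disp : measure_display} {T : measurableType disp}.
Variable P : probability T R.

Lemma expectation_simple (I : finType) (Q : pred I) (A : I -> set T) (v : I -> R) :
  (forall i, measurable (A i)) ->
  ('E_P[fun w => (\sum_(i | Q i) v i * \1_(A i) w)%R] =
   \sum_(i | Q i) (v i)%:E * P (A i))%E.
Proof.
move=> mA; rewrite unlock.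
have intA i : P.-integrable setT (fun w => ((\1_(A i) w)%:E : \bar R)).
  apply: integrable_indic => //.
under eq_integral do rewrite -sumEFin.
rewrite integral_sum // => [|i]; last first.
  by under eq_fun do rewrite EFinM; exact: integrableZl.
apply: eq_bigr => i _; under eq_integral do rewrite EFinM.
by rewrite integralZl // integral_indic // setIT.
Qed.

Lemma measurable_tuple_set1 k (y : k.-tuple nat) : measurable [set y].
Proof.
have -> : [set y] = \bigcap_(i in [set: 'I_k]) (@tnth k nat ^~ i) @^-1` [set tnth y i].
  apply/seteqP; split=> [z -> //|z yz]; apply: eq_from_tnth => i.
  exact: yz.
apply: fin_bigcap_measurable => [|i _]; first exact: finite_finset.
rewrite -[X in measurable X]setTI; exact: measurable_tnth.
Qed.

Context {K m B : nat} (n : 'I_m -> nat) (q : 'I_m -> 'cV[R]_(K + 1)).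
Context (Y : 'I_m -> {RV P >-> (K + 1).-tuple nat}).
Hypothesis hY : forall i, (0 < n i)%N -> multinomial_law (n i) (q i) (Y i).
Hypothesis hindep : mutually_independent (fun i => (0 < n i)%N) Y.
Hypothesis nB : forall i, (n i <= B)%N.

Local Notation outcome := {ffun 'I_m -> {ffun 'I_(K + 1) -> 'I_B.+1}}.

(** Under the two conditions on [phi], the integrand is a finite combination of indicators of the
    events [E s], whose probabilities factor by independence. *)
Lemma expectation_counts (phi : ('I_m -> (K + 1).-tuple nat) -> R) :
  (forall y y', (forall i, (0 < n i)%N -> y i = y' i) -> phi y = phi y') ->
  (forall y, ~~ valid_counts n y -> phi y = 0) ->
  'E_P[fun w => phi (fun i => Y i w)]%E =
  (\sum_(s : outcome) (\prod_i multinomial_pmf (n i) (q i) (count_tuple (s i))) *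
     phi (fun i => count_tuple (s i)))%:E.
Proof.
move=> phi_ext phi0.
pose ok (s : outcome) := [forall i, (\sum_c tnth (count_tuple (s i)) c == n i)%N].
pose D := [set i | (0 < n i)%N]%SET.
pose E (s : outcome) := \bigcap_(i in [set` D]) (Y i @^-1` [set count_tuple (s i)]).
have mE s : measurable (E s).
  apply: fin_bigcap_measurable => [|i _]; first exact: finite_finset.
  by apply: measurable_funPTI; exact: measurable_tuple_set1.
have PE s : ok s -> P (E s) =
    (\prod_i multinomial_pmf (n i) (q i) (count_tuple (s i)))%:E.
  move=> /forallP oks; rewrite hindep; last 2 first.
  - by move=> i; rewrite inE.
  - by move=> i; exact: measurable_tuple_set1.
  rewrite (eq_bigr (fun i => (multinomial_pmf (n i) (q i) (count_tuple (s i)))%:E)).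
    (* Independence yields a product over the observed settings. Where n_i = 0, [ok] forces zero
       counts, of weight 1, so the product extends to all settings. *)
    rewrite prodEFin; congr EFin; rewrite [LHS]big_mkcond.
    apply: eq_bigr => i _; rewrite inE lt0n.
    case: eqP (eqP (oks i)) => //= -> /eqP; rewrite sum_nat_eq0 => /forallP s0.
    rewrite /multinomial_pmf big1 ?eqxx => [|c _]; last by apply/eqP/(implyP (s0 c)).
    rewrite !big1 ?fact0 ?divr1 ?mulr1 // => c _;
      by rewrite (eqP (implyP (s0 c) isT)).
  by move=> i; rewrite inE => ni; exact: hY.
have -> : (fun w => phi (fun i => Y i w)) =
    (fun w => \sum_(s | ok s) phi (fun i => count_tuple (s i)) * \1_(E s) w).
  apply/funext => w; have [vw|nvw] := boolP (valid_counts n (fun i => Y i w)); last first.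
    rewrite phi0 // big1 // => s oks; rewrite indicE.
    case: (boolP (w \in E s)) => [|_]; last by rewrite mulr0.
    rewrite inE => wE; rewrite (phi_ext _ (fun i => Y i w)) ?phi0 ?mul0r // => i ni.
    by rewrite wE //= inE.
  move/forallP: vw => vw.
  (* The only [ok] outcome whose event contains [w]: the observed counts, which fit below [B], and
     zero counts at unobserved settings. *)
  pose s0 : outcome := [ffun i => if (0 < n i)%N then
    [ffun c => inord (tnth (Y i w) c)] else [ffun=> ord0]].
  have s0E i : (0 < n i)%N -> count_tuple (s0 i) = Y i w.
    move=> ni; apply: eq_from_tnth => c; rewrite tnth_mktuple ffunE ni ffunE inordK //.
    rewrite ltnS (leq_trans _ (nB i)) // -(eqP (implyP (vw i) ni)).
    by rewrite (bigD1 c) //= leq_addr.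
  have ok0 : ok s0.
    apply/forallP => i; have [ni|] := ltnP 0 (n i).
      by rewrite s0E // (implyP (vw i)).
    rewrite leqn0 => /eqP ni; rewrite ni big1 // => c _.
    by rewrite tnth_mktuple ffunE ni ffunE.
  rewrite (bigD1 s0) //= big1 => [|s /andP[/forallP oks ss0]].
    rewrite addr0 indicE mem_set ?mulr1; last by move=> i /=; rewrite inE => /s0E.
    by apply: phi_ext => i /s0E.
  rewrite indicE memNset ?mulr0 // => ws; case/eqP: ss0; apply/ffunP => i.
  apply/ffunP => c; apply: val_inj.
  have [ni|] := ltnP 0 (n i).
    have := congr1 (fun y => tnth y c) (s0E i ni).
    have /= -> : Y i w = count_tuple (s i) by apply: ws; rewrite /= inE.
    by rewrite !tnth_mktuple => ->.
  rewrite leqn0 => /eqP ni; have := oks i; rewrite ni sum_nat_eq0 => /forallP/(_ c).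
  by rewrite tnth_mktuple => /eqP sc; rewrite ffunE ni ffunE; exact: sc.
rewrite expectation_simple //.
rewrite [in RHS](bigID ok) /= [X in _ = (_ + X)%:E]big1 ?addr0 => [|s].
  rewrite -sumEFin; apply: eq_bigr => s oks.
  by rewrite PE // -EFinM mulrC.
rewrite negb_forall => /existsP[i si].
by rewrite (bigD1 i) //= /multinomial_pmf (negbTE si) !mul0r.
Qed.

End Expectation.

(** * The information matrix *)

Section ProductSums.
Context {R : realType} {m : nat} {O : finType} (w : 'I_m -> O -> R).
Hypothesis w1 : forall i, \sum_o w i o = 1.

(** Independence of the coordinates under product weights, by distributivity. *)
Lemma sum_ffun_prod (F : 'I_m -> O -> R) :
  \sum_(s : {ffun 'I_m -> O}) (\prod_i w i (s i)) * \prod_i F i (s i) =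
  \prod_i \sum_o w i o * F i o.
Proof. by rewrite bigA_distr_bigA; apply: eq_bigr => s _; rewrite big_split. Qed.

Lemma prod_if_eq (i : 'I_m) (f : 'I_m -> R) :
  \prod_k (if k == i then f k else 1) = f i.
Proof. by rewrite -big_mkcond big_pred1_eq. Qed.

Lemma sum_ffun_one (i : 'I_m) (f : O -> R) :
  \sum_(s : {ffun 'I_m -> O}) (\prod_k w k (s k)) * f (s i) = \sum_o w i o * f o.
Proof.
transitivity (\prod_k \sum_o w k o * (if k == i then f o else 1)).
  rewrite -(sum_ffun_prod (fun k o => if k == i then f o else 1)).
  by apply: eq_bigr => s _; rewrite (prod_if_eq i (fun k => f (s k))).
rewrite (bigD1 i) //= eqxx [X in _ * X]big1 ?mulr1 // => k /negbTE ->.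
by under eq_bigr do rewrite mulr1.
Qed.

Lemma sum_ffun_two (i j : 'I_m) (f g : O -> R) : i != j ->
  \sum_o w i o * f o = 0 ->
  \sum_(s : {ffun 'I_m -> O}) (\prod_k w k (s k)) * (f (s i) * g (s j)) = 0.
Proof.
move=> ij f0.
transitivity (\prod_k \sum_o w k o *
    ((if k == i then f o else 1) * (if k == j then g o else 1))).
  rewrite -(sum_ffun_prod (fun k o =>
    (if k == i then f o else 1) * (if k == j then g o else 1))).
  apply: eq_bigr => s _; rewrite big_split /=.
  by rewrite (prod_if_eq i (fun k => f (s k))) (prod_if_eq j (fun k => g (s k))).
rewrite (bigD1 i) //= eqxx (negbTE ij).
by under eq_bigr do rewrite mulr1; rewrite f0 mul0r.
Qed.

End ProductSums.

Lemma covariance_centered {R : realType} {disp : measure_display}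
    {T : measurableType disp} (P : probability T R) (F G : T -> R) :
  'E_P[F]%E = 0%E -> 'E_P[G]%E = 0%E ->
  covariance P F G = 'E_P[fun w => (F w * G w)%R]%E.
Proof.
move=> F0 G0; rewrite covariance.unlock F0 G0.
by congr expectation; apply/funext => w; rewrite !fctE /= !subr0.
Qed.

Section FisherInformation.
Context {R : realType} {K m p : nat} (t : logit_type) (n : 'I_m -> nat).
Context (X : 'I_m -> 'M[R]_(K, p)) (theta : 'cV[R]_p).
Hypothesis feas : feasible t (fun i => col_mx (X i) 0) theta.

Let q i := cell_prob t (col_mx (X i) 0) theta.

Let q0 i c : 0 < q i c 0. Proof. by have [] := cell_prob_ok (feas i). Qed.

Let q1 i : \sum_c q i c 0 = 1. Proof. by have [] := cell_prob_ok (feas i). Qed.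

Lemma score_coef_centered a i : \sum_c score_coef t X theta a i c * q i c 0 = 0.
Proof.
pose z := invmx (CDLmx t (q i)) *m (col_mx (X i) 0 *m (delta_mx a 0 : 'cV_p)).
transitivity (\sum_c z c 0).
  by apply: eq_bigr => c _; rewrite /score_coef divfK // gt_eqF ?q0.
have Ez : CDLmx t (q i) *m z = col_mx (X i *m delta_mx a 0) 0.
  by rewrite /z mulKVmx ?CDLmx_unit ?q0 // mul_col_mx mul0mx.
have := congr1 dsubmx Ez; rewrite CDLmx_mul ?q0 // !col_mxKd q1 divr1.
by move/matrixP/(_ ord0 ord0); rewrite !mxE eqxx mulr1n.
Qed.

Definition u_mx i : 'M[R]_K := \matrix_(r, s) u_coef t (q i) r s.

(** [C] keeps the columns $c_{i1},\dots,c_{i,J-1}$ of the inverse and drops the last one. *)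
Lemma u_mxE i :
  let C := lsubmx (invmx (CDLmx t (q i))) in
  u_mx i = C^T *m (invmx (diag_mx (q i)^T) *m C).
Proof.
move=> C; apply/matrixP => r s; rewrite mxE /u_coef.
have colE k : col (lshift 1 k) (invmx (CDLmx t (q i))) = col k C.
  by apply/colP => c; rewrite !mxE.
rewrite !colE -mulmxA -[col s C]colE -colE !mxE; apply: eq_bigr => c _.
rewrite !mxE; congr (_ * _).
by apply: eq_bigr => b _; rewrite !mxE.
Qed.

(** The zero last row of the model matrix leaves only [C] acting, so the derivatives of the cell
    probabilities are the columns of [C *m X i]. Two divisions by $q_c$ and one multiplication give
    the weight $1/q_c$. *)
Lemma sum_score_coef a b i :
  \sum_c score_coef t X theta a i c * score_coef t X theta b i c * q i c 0 =
  ((X i)^T *m u_mx i *m X i) a b.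
Proof.
rewrite u_mxE; set C := lsubmx _.
have zE d : invmx (CDLmx t (q i)) *m (col_mx (X i) 0 *m (delta_mx d 0 : 'cV_p)) =
    col d (C *m X i).
  rewrite mul_col_mx mul0mx -[invmx _]hsubmxK mul_row_col mulmx0 addr0.
  by rewrite -/C mulmxA -colE.
have -> : (X i)^T *m (C^T *m (invmx (diag_mx (q i)^T) *m C)) *m X i =
    (C *m X i)^T *m (invmx (diag_mx (q i)^T) *m (C *m X i)).
  by rewrite trmx_mul !mulmxA.
set Z := C *m X i.
transitivity (((Z^T) *m (invmx (diag_mx (q i)^T) *m col b Z)) a 0); last first.
  by rewrite !colE !mulmxA -colE [LHS]mxE.
rewrite invmx_diag_mul => [|c]; last by rewrite gt_eqF.
rewrite mxE; apply: eq_bigr => c _; rewrite /score_coef -/(q i) !zE !mxE.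
by have qc := lt0r_neq0 (q0 i c); field.
Qed.

Context {disp : measure_display} {T : measurableType disp} (P : probability T R).
Context (Y : 'I_m -> {RV P >-> (K + 1).-tuple nat}).
Hypothesis hY : forall i, (0 < n i)%N -> multinomial_law (n i) (q i) (Y i).
Hypothesis hindep : mutually_independent (fun i => (0 < n i)%N) Y.

Let N := (\sum_(i < m) n i)%N.

Let nN i : (n i <= N)%N. Proof. by rewrite /N (bigD1 i) //= leq_addr. Qed.

(** The closed form of the score given by [scoreE]. *)
Let S a (y : 'I_m -> (K + 1).-tuple nat) : R :=
  if valid_counts n y then
    \sum_(i < m | (0 < n i)%N) lin_count (score_coef t X theta a i) (y i)
  else 0.

Let S_ext a y y' : (forall i, (0 < n i)%N -> y i = y' i) -> S a y = S a y'.
Proof.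
move=> yy; rewrite /S.
have -> : valid_counts n y = valid_counts n y'.
  by apply: eq_forallb => i; case: ltnP => //= ni; rewrite yy.
by case: ifP => // _; apply: eq_bigr => i ni; rewrite yy.
Qed.

Local Notation outcome := {ffun 'I_m -> {ffun 'I_(K + 1) -> 'I_N.+1}}.

Let W i (o : {ffun 'I_(K + 1) -> 'I_N.+1}) := multinomial_pmf (n i) (q i) (count_tuple o).

Let W1 i : \sum_o W i o = 1. Proof. exact: sum_multinomial_pmf. Qed.

(** Outcomes with invalid counts have weight zero, which removes the case distinction of [S] under
    weighted sums. *)
Let weighted_S (s : outcome) (f : R) (F : ('I_m -> (K + 1).-tuple nat) -> R) :
  (valid_counts n (fun i => count_tuple (s i)) -> F (fun i => count_tuple (s i)) = f) ->
  (\prod_i W i (s i)) * F (fun i => count_tuple (s i)) = (\prod_i W i (s i)) * f.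
Proof.
move=> Ff; have [/Ff -> //|] := boolP (valid_counts n (fun i => count_tuple (s i))).
rewrite negb_forall => /existsP[i]; rewrite negb_imply => /andP[_ si].
by rewrite (bigD1 i) //= {1 3}/W /multinomial_pmf (negbTE si) !mul0r.
Qed.

Lemma expectation_score a : 'E_P[fun w => S a (fun i => Y i w)]%E = 0%E.
Proof.
rewrite (expectation_counts hY hindep nN (@S_ext a)); last first.
  by move=> y /negbTE vy; rewrite /S vy.
congr EFin; transitivity (\sum_(s : outcome) (\prod_i W i (s i)) *
    \sum_(i < m | (0 < n i)%N)
      lin_count (score_coef t X theta a i) (count_tuple (s i))).
  by apply: eq_bigr => s _; apply: (weighted_S (F := S a)) => vs; rewrite /S vs.
under eq_bigr do rewrite mulr_sumr.
rewrite exchange_big big1 //= => i _.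
rewrite (sum_ffun_one W1 i (fun o => lin_count _ (count_tuple o))).
by rewrite multinomial_mean // score_coef_centered mulr0.
Qed.

Lemma expectation_score_mul a b :
  'E_P[fun w => (S a (fun i => Y i w) * S b (fun i => Y i w))%R]%E =
  ((\sum_i (n i)%:R *: ((X i)^T *m u_mx i *m X i)) a b)%:E.
Proof.
rewrite (expectation_counts (phi := fun y => S a y * S b y) hY hindep nN); last 2 first.
- by move=> y y' yy; rewrite !(S_ext _ yy).
- by move=> y /negbTE vy; rewrite /S vy mul0r.
congr EFin; pose l a i o := lin_count (score_coef t X theta a i)
  (@count_tuple K N o).
transitivity (\sum_(s : outcome) (\prod_i W i (s i)) *
    ((\sum_(i < m | (0 < n i)%N) l a i (s i)) *
     (\sum_(j < m | (0 < n j)%N) l b j (s j)))).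
  apply: eq_bigr => s _; apply: (weighted_S (F := fun y => S a y * S b y)) => vs.
  by rewrite /S vs.
transitivity (\sum_(i < m | (0 < n i)%N) \sum_(j < m | (0 < n j)%N)
    \sum_(s : outcome) (\prod_k W k (s k)) * (l a i (s i) * l b j (s j))).
  under [RHS]eq_bigr do rewrite exchange_big; rewrite exchange_big.
  apply: eq_bigr => s _; rewrite mulr_suml mulr_sumr; apply: eq_bigr => i _.
  by rewrite !mulr_sumr.
have l0 a' i : \sum_o W i o * l a' i o = 0.
  by rewrite multinomial_mean // score_coef_centered mulr0.
rewrite summxE [RHS](bigID (fun i => 0 < n i)%N) /=.
rewrite [X in _ = _ + X]big1 ?addr0; last first.
  by move=> i; rewrite -eqn0Ngt => /eqP ->; rewrite scale0r mxE.
(* For distinct settings the weights separate and the factor at [i] has mean zero; only [j = i]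
   survives. *)
apply: eq_bigr => i ni; rewrite (bigD1 i) //= [X in _ + X]big1 ?addr0; last first.
  by move=> j /andP[_ ji]; apply: sum_ffun_two; rewrite 1?eq_sym.
rewrite (sum_ffun_one W1 i (fun o => l a i o * l b i o)).
by rewrite multinomial_cov ?score_coef_centered // sum_score_coef [RHS]mxE.
Qed.

Lemma fisher_info_sum :
  fisher_info t n (fun i => col_mx (X i) 0) Y theta =
  map_mx EFin (\sum_i (n i)%:R *: ((X i)^T *m u_mx i *m X i)).
Proof.
apply/matrixP => a b; rewrite [LHS]mxE [RHS]mxE -expectation_score_mul.
have SE c : (fun w => score t n (fun i => col_mx (X i) 0) theta (fun i => Y i w) c) =
    (fun w => S c (fun i => Y i w)).
  by apply/funext => w; exact: scoreE.
transitivity (covariance P (fun w => S a (fun i => Y i w))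
                           (fun w => S b (fun i => Y i w))).
  exact: congr2 (SE a) (SE b).
by rewrite covariance_centered // expectation_score.
Qed.

End FisherInformation.

(** * The block form of the information matrix *)

Section BlockForm.
Context {R : realType} {K d m : nat} {p_ : 'I_K -> nat} {pc : nat}.
Context (h : forall j : 'I_K, 'cV[R]_d -> 'cV[R]_(p_ j)) (hc : 'cV[R]_d -> 'cV[R]_pc).
Context (x : 'I_m -> 'cV[R]_d).

Let M i := usubmx (model_mx h hc (x i)).

(** Column i of the s-th column block of H is the transposed s-th row of $X_i$. *)
Lemma Hmx_mxrow :
  Hmx h hc x =
  \mxrow_(s < K) \matrix_(a < \sum_(j < K) p_ j + pc, i < m) M i s a.
Proof.
apply/matrixP => a k; rewrite [RHS]mxE [RHS]mxE /M col_mxKu /Hmx.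
case: (split_ordP a) => b ->.
  rewrite col_mxEu row_mxEl [LHS]mxE [RHS]mxE [RHS]mxE.
  by rewrite eq_sym; case: eqP => _; rewrite mxE.
by rewrite col_mxEd row_mxEr !mxE.
Qed.

(** The blocks of U are diagonal, so they pair columns of H belonging to the same setting;
    exchanging sums brings the sum over settings outside. *)
Lemma HUH_sum t (n : 'I_m -> nat) (q : 'I_m -> 'cV[R]_(K + 1)) :
  Hmx h hc x *m Umx t n q *m (Hmx h hc x)^T =
  \sum_i (n i)%:R *: ((M i)^T *m (\matrix_(r, s) u_coef t (q i) r s) *m M i).
Proof.
rewrite Hmx_mxrow /Umx mul_mxrow_mxblock tr_mxrow mul_mxrow_mxcol.
apply/matrixP => a b; rewrite !summxE.
transitivity (\sum_(s < K) \sum_(i < m) \sum_(r < K)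
    (n i)%:R * (M i r a * u_coef t (q i) r s * M i s b)).
  apply: eq_bigr => s _; rewrite mxE; apply: eq_bigr => i _.
  rewrite summxE mulr_suml; apply: eq_bigr => r _.
  by rewrite mul_mx_diag !mxE; ring.
rewrite exchange_big; apply: eq_bigr => i _ /=.
rewrite mxE mxE mulr_sumr; apply: eq_bigr => s _.
rewrite [X in _ = _ * (X * _)]mxE mulr_suml mulr_sumr; apply: eq_bigr => r _.
by rewrite !mxE.
Qed.

End BlockForm.

Theorem theorem3p1 (R : realType) (d m K : nat)
    (hd : (1 <= d)%N) (hm : (2 <= m)%N) (hK : (2 <= K + 1)%N)
    (x : 'I_m -> 'cV[R]_d) (hx : injective x)
    (n : 'I_m -> nat) (hn : (0 < \sum_(i < m) n i)%N)
    (t : logit_type) (p_ : 'I_K -> nat) (pc : nat)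
    (h : forall j : 'I_K, 'cV[R]_d -> 'cV[R]_(p_ j))
    (hc : 'cV[R]_d -> 'cV[R]_pc)
    (X := fun i => model_mx h hc (x i))
    (theta : 'cV[R]_(\sum_(j < K) p_ j + pc)) (htheta : feasible t X theta)
    (pi := fun i => cell_prob t (X i) theta)
    (disp : measure_display) (T : measurableType disp) (P : probability T R)
    (Y : 'I_m -> {RV P >-> (K + 1).-tuple nat})
    (hY : forall i, (0 < n i)%N -> multinomial_law (n i) (pi i) (Y i))
    (hindep : mutually_independent (fun i => (0 < n i)%N) Y) :
  fisher_info t n X Y theta =
  map_mx EFin (Hmx h hc x *m Umx t n pi *m (Hmx h hc x)^T).
Proof.
(* Exposes the zero last row of each model matrix, the form in which the preceding results are
   stated. *)
have XE : X = (fun i => col_mx (usubmx (X i)) 0).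
  by apply/funext => i; rewrite /X /model_mx col_mxKu.
have piE : pi = (fun i => cell_prob t (col_mx (usubmx (X i)) 0) theta).
  by apply/funext => i; rewrite /pi {1}XE.
rewrite HUH_sum piE {1}XE; apply: fisher_info_sum => // [|i ni].
  by rewrite -XE.
by have := hY i ni; rewrite piE.
Qed.
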